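(* Let $\Lambda$ be a commutative discrete valuation ring and let $(A\subset B)$ be an embedding of $\Lambda$-modules. Then the socle tableau $\Sigma$ of $(A\subset B)$ satisfies the conditions: (ST-1) in each row, the entries are weakly decreasing (from left to right); (ST-2) in each column, the entries are strictly decreasing (from top to bottom); (ST-3) for each vertical line, and each natural number $\ell\ge1$, there are at most as many entries $\ell+1$ on the left hand side of the line as there are entries $\ell$.
   Context: Let $p$ be a generator of the maximal ideal of $\Lambda$. All $\Lambda$-modules have finite length. For a partition $\lambda=(\lambda_1\ge\dots\ge\lambda_n\geq 1)$ put $N_\lambda=\Lambda/(p^{\lambda_1})\oplus\cdots\oplus\Lambda/(p^{\lambda_n})$; a $\Lambda$-module $M$ has type $\lambda$ if $M\cong N_\lambda$. An embedding $(A\subset B)$ consists of a $\Lambda$-module $B$ and a submodule $A$. $\mathrm{soc}^\ell A=\{a\in A:p^\ell a=0\}$. The Young diagram of $\lambda$ is drawn with columns of lengths $\lambda_1,\lambda_2,\dots$ from left to right, aligned at the top; rows are numbered from top to bottom. For partitions $\gamma\le\beta$ (i.e. $\gamma_i\le\beta_i$ for all $i$), the skew diagram $\beta\setminus\gamma$ consists of the boxes in row $r$ and column $j$ with $\gamma_j<r\le\beta_j$. Let $A,B,B/A$ have types $\alpha,\beta,\gamma$ and let $s=\alpha_1$. Let $\sigma^{(i)}$ be the type of $B/\mathrm{soc}^iA$ for $0\le i\le s$; this gives a decreasing sequence $\beta=\sigma^{(0)}\ge\sigma^{(1)}\ge\cdots\ge\sigma^{(s)}=\gamma$. The socle tableau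 $\Sigma$ of the embedding is the filling of the skew diagram $\beta\setminus\gamma$ in which the boxes of $\sigma^{(\ell-1)}\setminus\sigma^{(\ell)}$ have entry $\ell$, for $\ell=1,\dots,s$. *)

(* Defs.v *)
(* boolp is used only to turn existential predicates into booleans. *)
From HB Require Import structures.
From mathcomp Require Import all_boot all_order all_algebra.
From mathcomp Require Import generic_quotient ring_quotient boolp.

Set Implicit Arguments.
Unset Strict Implicit.
Unset Printing Implicit Defensive.

Import GRing.Theory.
Local Open Scope ring_scope.
Local Open Scope quotient_scope.

Section SubmoduleAndQuotient.
Variables (R : comNzRingType) (V : lmodType R) (A : submodClosed V).

Definition submod_type : Type := {x : V | x \in A}.
HB.instance Definition _ := Choice.on submod_type.
HB.instance Definition _ := SubType.on submod_type.
HB.instance Definition _ := [SubChoice_isSubLmodule of submod_type by <:].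

(* The set A again. SubmodClosed does not inherit from ZmodClosed, which
   Quotient.quot requires; this alias carries both structures. *)
Definition submod_mem : {pred V} := fun x => x \in A.

Lemma submod_mem_closed : GRing.subsemimod_closed submod_mem.
Proof. exact: GRing.subsemimodClosedP. Qed.
HB.instance Definition _ :=
  GRing.isSubmodClosed.Build R V submod_mem submod_mem_closed.

(* Quotient.quot only has a Z-module structure; quot_mod adds the scaling. *)
Definition quot_mod : Type := Quotient.quot submod_mem.
HB.instance Definition _ := Choice.on quot_mod.
HB.instance Definition _ := GRing.Zmodule.on quot_mod.
HB.instance Definition _ := EqQuotient.on quot_mod.
HB.instance Definition _ :=
  @isZmodQuotient.Build V (Quotient.equiv submod_mem) 0 -%R +%R quot_mod
    (@pi_zeror _ _ _ _ _ (Quotient.quot submod_mem))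
    (@pi_oppr _ _ _ _ _ (Quotient.quot submod_mem))
    (@pi_addr _ _ _ _ _ (Quotient.quot submod_mem)).

Definition quot_scale (a : R) (x : quot_mod) : quot_mod :=
  \pi_quot_mod (a *: repr x).

Lemma pi_quot_modE (u v : V) :
  (\pi_quot_mod u == \pi_quot_mod v) = (u - v \in A).
Proof. by symmetry; apply: (Quotient.idealrBE submod_mem u v). Qed.

Lemma pi_scale (a : R) (v : V) :
  \pi_quot_mod (a *: v) = quot_scale a (\pi_quot_mod v).
Proof.
apply/eqP; rewrite pi_quot_modE -scalerBr rpredZ // -pi_quot_modE.
by rewrite reprK.
Qed.

Lemma pi_quot_mod_surj (x : quot_mod) : exists v : V, x = \pi_quot_mod v.
Proof. by exists (repr x); rewrite reprK. Qed.

Lemma quot_scalerA a b x : quot_scale a (quot_scale b x) = quot_scale (a * b) x.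
Proof. by have [v ->] := pi_quot_mod_surj x; rewrite -!pi_scale scalerA. Qed.

Lemma quot_scale1r : left_id 1 quot_scale.
Proof.
by move=> x; have [v ->] := pi_quot_mod_surj x; rewrite -pi_scale scale1r.
Qed.

Lemma quot_scalerDr : right_distributive quot_scale +%R.
Proof.
move=> a x y; have [u ->] := pi_quot_mod_surj x.
have [v ->] := pi_quot_mod_surj y.
by rewrite -!pi_scale -!raddfD /= -pi_scale scalerDr.
Qed.

Lemma quot_scalerDl x : {morph quot_scale^~ x : a b / a + b}.
Proof.
move=> a b; have [v ->] := pi_quot_mod_surj x.
by rewrite -!pi_scale scalerDl raddfD.
Qed.

HB.instance Definition _ := GRing.Zmodule_isLmodule.Build R quot_mod
  quot_scalerA quot_scale1r quot_scalerDr quot_scalerDl.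

Lemma pi_quot_mod_scalable : scalable (\pi_quot_mod : V -> quot_mod).
Proof. exact: pi_scale. Qed.
HB.instance Definition _ :=
  GRing.isScalable.Build R V quot_mod *:%R (\pi_quot_mod) pi_quot_mod_scalable.

End SubmoduleAndQuotient.

(* Ideals of R are the submodCloseds of the regular module R^o. *)
Section Principal.
Variables (R : comNzRingType) (a : R).

Definition principal : {pred R^o} := fun x => `[< exists b : R, x = b * a >].

Lemma principal_submod : GRing.subsemimod_closed principal.
Proof.
split; first split.
- by apply/asboolP; exists 0; rewrite mul0r.
- move=> x y /asboolP[b ->] /asboolP[c ->].
  by apply/asboolP; exists (b + c); rewrite mulrDl.
- move=> c x /asboolP[b ->].
  by apply/asboolP; exists (c * b); rewrite -mulrA.
Qed.
HB.instance Definition _ :=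
  GRing.isSubmodClosed.Build R R^o principal principal_submod.

End Principal.

Definition maximal_ideal (R : comNzRingType) (I : submodClosed R^o) : Prop :=
  1 \notin I /\
  forall J : submodClosed R^o, {subset I <= J} -> 1 \notin J -> I =i J.

Definition is_pid (R : idomainType) : Prop :=
  forall I : submodClosed R^o, exists a : R, I =i principal a.

Definition is_dvr (R : idomainType) : Prop :=
  is_pid R /\
  exists I : submodClosed R^o,
    [/\ maximal_ideal I,
        forall J : submodClosed R^o, maximal_ideal J -> I =i J
      & exists2 x : R^o, x \in I & x != 0].

Definition uniformizer (R : idomainType) (p : R) : Prop :=
  maximal_ideal (principal p).

Definition finite_length (R : comNzRingType) (V : lmodType R) : Prop :=
  exists n : nat, forall (k : nat) (C : nat -> submodClosed V),
    (forall i, (i < k)%N ->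
       {subset C i <= C i.+1} /\ ~ {subset C i.+1 <= C i}) ->
    (k <= n)%N.

Definition lmod_iso (R : comNzRingType) (V W : lmodType R) : Prop :=
  exists f : {linear V -> W}, bijective f.

Definition is_partition (la : seq nat) : bool :=
  sorted geq la && (0%N \notin la).

Fixpoint N_ (R : comNzRingType) (p : R) (la : seq nat) : lmodType R :=
  if la is k :: la' then (quot_mod (principal (p ^+ k)) * N_ p la')%type
  else 'rV[R]_0.

Definition has_type (R : comNzRingType) (p : R) (M : lmodType R)
    (la : seq nat) : Prop :=
  is_partition la /\ lmod_iso M (N_ p la).

Section Socle.
Variables (R : comNzRingType) (p : R) (V : lmodType R) (A : submodClosed V).
Variable l : nat.

Definition soc : {pred V} := [pred a | (a \in A) && (p ^+ l *: a == 0)].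

Lemma soc_submod : GRing.subsemimod_closed soc.
Proof.
split; first split.
- by rewrite inE rpred0 scaler0 eqxx.
- move=> x y; rewrite !inE => /andP[Ax /eqP px] /andP[Ay /eqP py].
  by rewrite rpredD // scalerDr px py addr0 eqxx.
- move=> c x; rewrite !inE => /andP[Ax /eqP px].
  by rewrite rpredZ //= scalerA mulrC -scalerA px scaler0.
Qed.
HB.instance Definition _ := GRing.isSubmodClosed.Build R V soc soc_submod.

End Socle.

(* Rows r are numbered from 1; columns j are numbered from 0, so that column j
   of the diagram of la has length nth 0 la j. *)
Definition in_skew (be ga : seq nat) (r j : nat) : bool :=
  (nth 0 ga j < r <= nth 0 be j)%N.

(* A filling is a function T, T r j being the entry in row r and column j; its
   values off the skew diagram at hand are irrelevant. *)
Definition is_socle_tableau (R : comNzRingType) (p : R) (B : lmodType R)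
    (A : submodClosed B) (al : seq nat) (T : nat -> nat -> nat) : Prop :=
  let s := head 0%N al in
  exists sigma : nat -> seq nat,
    (forall i, (i <= s)%N -> has_type p (quot_mod (soc p A i)) (sigma i)) /\
    (forall l, (1 <= l <= s)%N ->
       forall r j, in_skew (sigma l.-1) (sigma l) r j -> T r j = l).

Definition ST1 (be ga : seq nat) (T : nat -> nat -> nat) : Prop :=
  forall r j j', (j < j')%N -> in_skew be ga r j -> in_skew be ga r j' ->
    (T r j' <= T r j)%N.

Definition ST2 (be ga : seq nat) (T : nat -> nat -> nat) : Prop :=
  forall j r r', (r < r')%N -> in_skew be ga r j -> in_skew be ga r' j ->
    (T r' j < T r j)%N.

(* The boxes with entry l in the first m columns, i.e. to the left of the
   vertical line between columns m - 1 and m. *)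
Definition boxes_left (be ga : seq nat) (T : nat -> nat -> nat) (m l : nat) :
    {set 'I_(head 0%N be).+1 * 'I_(size be)} :=
  [set b : 'I_(head 0%N be).+1 * 'I_(size be) |
     [&& in_skew be ga b.1 b.2, (b.2 < m)%N & T b.1 b.2 == l]].

Definition ST3 (be ga : seq nat) (T : nat -> nat -> nat) : Prop :=
  forall m l, (1 <= l)%N ->
    (#|boxes_left be ga T m l.+1| <= #|boxes_left be ga T m l|)%N.

(* Main.v *)
(* Write [S_l] for [soc^l A] and [f_m l] for the sum of the first [m] parts of
   the type [sigma l] of [B / S_l].

   The number of parts of [sigma l] exceeding [i] is the length of
   [p^i (B / S_l)] modulo [p^(i+1) (B / S_l)]. Since [S_l <= S_(l+1)] and
   [p S_(l+1) <= S_l], column by column [sigma l] exceeds [sigma l.+1] by 0 or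
   1.
   This gives (ST-1) and (ST-2).

   (ST-3) is the convexity of [f_m]. The sum [f_m l] is the maximal length of a
   submodule of [B / S_l] generated by [m] elements. Let [X <= B], generated by
   [m] elements, have an image of maximal length in [B / S_(l+1)]. The images of
   [X] in [B / S_l], [B / S_(l+1)], [B / S_(l+2)] have lengths [u + v + w],
   [v + w], [w], where [u] and [v] are the lengths of
   [(X :&: S_(l+1)) / (X :&: S_l)] and [(X :&: S_(l+2)) / (X :&: S_(l+1))].
   Multiplication by [p] embeds the latter module in the former, so [v <= u].

   All lengths are taken inside [B], as maximal lengths of strict chains between
   two submodules. *)
Require Import Defs.
From mathcomp Require Import all_boot all_order all_algebra.
From HB Require Import structures.
From mathcomp Require Import generic_quotient boolp zify.

Set Implicit Arguments.
Unset Strict Implicit.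
Unset Printing Implicit Defensive.

Import GRing.Theory.
Local Open Scope ring_scope.
Local Open Scope quotient_scope.

(** * Submodules and lengths *)

Section Submodules.
Variables (R : comNzRingType) (V : lmodType R).
Implicit Types S U X Y Z W : submodClosed V.

Lemma submodN X x : x \in X -> - x \in X.
Proof. by move=> Xx; rewrite -scaleN1r rpredZ. Qed.

Lemma submodB X x y : x \in X -> y \in X -> x - y \in X.
Proof. by move=> Xx Xy; rewrite rpredD ?submodN. Qed.

Lemma submodBl X x y : x - y \in X -> y \in X -> x \in X.
Proof. by move=> Xxy Xy; rewrite -(subrK y x) rpredD. Qed.

Lemma submodBr X x y : x - y \in X -> x \in X -> y \in X.
Proof. by move=> Xxy Xx; rewrite -(subKr x y) submodB. Qed.

Definition zerosm : {pred V} := fun x => x == 0.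

Lemma zerosm_closed : GRing.subsemimod_closed zerosm.
Proof.
split; first split; first exact: eqxx.
- by move=> x y /eqP-> /eqP->; rewrite addr0; exact: eqxx.
- by move=> c x /eqP->; rewrite scaler0; exact: eqxx.
Qed.
HB.instance Definition _ :=
  GRing.isSubmodClosed.Build R V zerosm zerosm_closed.

Definition topsm : {pred V} := fun=> true.

Lemma topsm_closed : GRing.subsemimod_closed topsm.
Proof. by []. Qed.
HB.instance Definition _ :=
  GRing.isSubmodClosed.Build R V topsm topsm_closed.

Definition capsm X Y : {pred V} := fun x => (x \in X) && (x \in Y).

Lemma capsm_closed X Y : GRing.subsemimod_closed (capsm X Y).
Proof.
split; first split; first by apply/andP; rewrite !rpred0.
- by move=> x y /andP[? ?] /andP[? ?]; apply/andP; rewrite !rpredD.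
- by move=> c x /andP[? ?]; apply/andP; rewrite !rpredZ.
Qed.
HB.instance Definition _ X Y :=
  GRing.isSubmodClosed.Build R V (capsm X Y) (capsm_closed X Y).

Definition preimsm a X : {pred V} := fun x => a *: x \in X.

Lemma in_preimsm a X x : (x \in preimsm a X) = (a *: x \in X).
Proof. by []. Qed.

Lemma preimsm_closed a X : GRing.subsemimod_closed (preimsm a X).
Proof.
split; first split; first by rewrite in_preimsm scaler0 rpred0.
- by move=> x y; rewrite !in_preimsm => Xx Xy; rewrite scalerDr rpredD.
- move=> c x; rewrite !in_preimsm => Xx.
  by rewrite scalerA mulrC -scalerA rpredZ.
Qed.
HB.instance Definition _ a X :=
  GRing.isSubmodClosed.Build R V (preimsm a X) (preimsm_closed a X).

(* [a X + Y] *)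
Definition scalesm a X Y : {pred V} :=
  fun x => `[< exists2 u, u \in X & x - a *: u \in Y >].

Lemma scalesmP a X Y x :
  reflect (exists2 u, u \in X & x - a *: u \in Y) (x \in scalesm a X Y).
Proof. exact: asboolP. Qed.

Lemma scalesm_closed a X Y : GRing.subsemimod_closed (scalesm a X Y).
Proof.
split; first split.
- by apply/scalesmP; exists 0; rewrite ?scaler0 ?subr0 rpred0.
- move=> x y /scalesmP[u Xu Yu] /scalesmP[v Xv Yv].
  apply/scalesmP; exists (u + v); first exact: rpredD.
  by rewrite scalerDr opprD addrACA rpredD.
- move=> c x /scalesmP[u Xu Yu]; apply/scalesmP; exists (c *: u).
    exact: rpredZ.
  by rewrite scalerA mulrC -scalerA -scalerBr rpredZ.
Qed.
HB.instance Definition _ a X Y :=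
  GRing.isSubmodClosed.Build R V (scalesm a X Y) (scalesm_closed a X Y).

Lemma sub_scalesm a X Y : {subset Y <= scalesm a X Y}.
Proof.
by move=> y Yy; apply/scalesmP; exists 0; rewrite ?rpred0 // scaler0 subr0.
Qed.

(* [Y + <x_0, ..., x_(n-1)>] *)
Definition spansm Y (x : nat -> V) n : {pred V} :=
  fun z => `[< exists c : nat -> R, z - \sum_(j < n) c j *: x j \in Y >].

Lemma spansmP Y (x : nat -> V) n z :
  reflect (exists c : nat -> R, z - \sum_(j < n) c j *: x j \in Y)
          (z \in spansm Y x n).
Proof. exact: asboolP. Qed.

Lemma spansm_closed Y (x : nat -> V) n : GRing.subsemimod_closed (spansm Y x n).
Proof.
split; first split.
- apply/spansmP; exists (fun=> 0); rewrite big1 ?subr0 ?rpred0 // => j _.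
  by rewrite scale0r.
- move=> y z /spansmP[c Yc] /spansmP[d Yd].
  apply/spansmP; exists (fun j => c j + d j).
  under eq_bigr do rewrite scalerDl.
  by rewrite big_split /= opprD addrACA rpredD.
- move=> a y /spansmP[c Yc]; apply/spansmP; exists (fun j => a * c j).
  under eq_bigr do rewrite -scalerA.
  by rewrite -scaler_sumr -scalerBr rpredZ.
Qed.
HB.instance Definition _ Y x n :=
  GRing.isSubmodClosed.Build R V (spansm Y x n) (spansm_closed Y x n).

Lemma sub_spansm Y (x : nat -> V) n : {subset Y <= spansm Y x n}.
Proof.
move=> y Yy; apply/spansmP; exists (fun=> 0).
by rewrite big1 ?subr0 // => j _; rewrite scale0r.
Qed.

Lemma spansm0 Y (x : nat -> V) : {subset spansm Y x 0 <= Y}.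
Proof. by move=> y /spansmP[c]; rewrite big_ord0 subr0. Qed.

Lemma spansmSP Y (x : nat -> V) n z :
  reflect (exists c : R, z - c *: x n \in spansm Y x n)
          (z \in spansm Y x n.+1).
Proof.
apply: (iffP (spansmP _ _ _ _)) => [[c]|[a /spansmP[c]]].
  rewrite big_ord_recr /= => Yz; exists (c n); apply/spansmP; exists c.
  by rewrite -addrA -opprD addrC [_ *: _ + _]addrC addrC.
move=> Yz; exists (fun j => if j == n then a else c j).
rewrite big_ord_recr /= eqxx [X in - (X + _)](_ : _ = \sum_(j < n) c j *: x j).
  by rewrite opprD [- _ - _]addrC addrA.
by apply: eq_bigr => j _; rewrite ltn_eqF.
Qed.

Lemma spansmS Y (x : nat -> V) n : {subset spansm Y x n <= spansm Y x n.+1}.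
Proof. by move=> z Yz; apply/spansmSP; exists 0; rewrite scale0r subr0. Qed.

Lemma mem_spansmS Y (x : nat -> V) n : x n \in spansm Y x n.+1.
Proof. by apply/spansmSP; exists 1; rewrite scale1r subrr rpred0. Qed.

(** The lowest member only has to contain [Y], which makes the predicate monotone at both ends. *)
Fixpoint chain Y (k : nat) X : Prop :=
  if k is k'.+1 then
    exists W, [/\ chain Y k' W, {subset W <= X} & ~ {subset X <= W}]
  else {subset Y <= X}.

Lemma chain_sub Y k X : chain Y k X -> {subset Y <= X}.
Proof.
elim: k X => //= k IH X [W [/IH YW WX _]] y Yy.
exact: WX (YW y Yy).
Qed.

Lemma chain_subr Y k X X' : {subset X <= X'} -> chain Y k X -> chain Y k X'.
Proof.
case: k => [|k] /= XX'; first by move=> YX y /YX/XX'.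
move=> [W [cW WX nXW]]; exists W; split=> // [w /WX/XX' //|X'W].
by apply: nXW => x /XX'/X'W.
Qed.

Lemma chain_subl Y k X Y' : {subset Y' <= Y} -> chain Y k X -> chain Y' k X.
Proof.
move=> Y'Y; elim: k X => [|k IH] X /=; first by move=> YX y /Y'Y/YX.
by move=> [W [/IH cW ? ?]]; exists W.
Qed.

Lemma chain_cat Y j Z k X : chain Y j Z -> chain Z k X -> chain Y (j + k) X.
Proof.
move=> cY; elim: k X => [|k IH] X /=.
  by rewrite addn0 => /chain_subr; apply.
by rewrite addnS => -[W [/IH cW ? ?]]; exists W.
Qed.

Lemma chain_leq Y j k X : (j <= k)%N -> chain Y k X -> chain Y j X.
Proof.
elim: k X => [|k IH] X; first by rewrite leqn0 => /eqP->.
rewrite leq_eqVlt => /predU1P[-> //|jk] /= [W [/(IH _ jk) cW WX _]].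
exact: chain_subr WX cW.
Qed.

(** Properness is a negated inclusion, so it survives any [phi] that reflects inclusions. Images and
    preimages under a scalar need not do so outside the interval from [Y] to [X]. *)
Lemma chain_map (phi : submodClosed V -> submodClosed V) Y k X Y' X' :
  (forall Z W, {subset Y <= Z} -> {subset Z <= W} -> {subset W <= X} ->
     {subset phi Z <= phi W} /\
     ({subset phi W <= phi Z} -> {subset W <= Z})) ->
  {subset Y' <= phi Y} -> {subset phi X <= X'} ->
  chain Y k X -> chain Y' k X'.
Proof.
move=> phiP Y'Y; elim: k X X' phiP => [|k IH] X X' phiP XX' /=.
  move=> YX; have [phiYX _] := phiP Y X (fun=> id) YX (fun=> id).
  by move=> y /Y'Y/phiYX/XX'.
move=> [W [cW WX nXW]].
have [WX' nXW'] := phiP W X (chain_sub cW) WX (fun=> id).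
exists (phi W); split=> [|w /WX'/XX' //|X'W].
  apply: IH cW => // Z W0 YZ ZW0 W0W; apply: phiP => // w /W0W; exact: WX.
by apply: nXW; apply: nXW' => x /XX'/X'W.
Qed.

Lemma chain_seq Y k X : chain Y k X ->
  exists2 C : nat -> submodClosed V, C k = X &
    forall i, (i < k)%N ->
      {subset C i <= C i.+1} /\ ~ {subset C i.+1 <= C i}.
Proof.
elim: k X => [|k IH] X /=; first by exists (fun=> X).
move=> [W [/IH[C CkW CP] WX nXW]].
exists (fun i => if (i <= k)%N then C i else X); first by rewrite ltnn.
move=> i; rewrite ltnS leq_eqVlt => /predU1P[->|ik].
  by rewrite eqxx ltnn CkW.
by rewrite ik orbT; apply: CP.
Qed.

(** * Length of one submodule over another *)

Section Length.
Hypothesis finV : finite_length V.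

(** The bound chosen from [finV] only makes the maximum finite: no chain exceeds it. The value is 0
    when [Y] is not contained in [X]. *)
Definition len Y X : nat :=
  let n := projT1 (cid finV) in \max_(k < n.+1 | `[< chain Y k X >]) k.

Lemma chain_len Y k X : chain Y k X -> (k <= len Y X)%N.
Proof.
rewrite /len; case: (cid finV) => n /= finn cX.
have kn : (k < n.+1)%N by have [C _ CP] := chain_seq cX; exact: finn CP.
by apply: (bigmax_sup (Ordinal kn)) => //; apply/asboolP.
Qed.

Lemma lenP Y X : {subset Y <= X} -> chain Y (len Y X) X.
Proof.
move=> YX; rewrite /len; apply: (big_ind (fun k => chain Y k X)) => //.
  by move=> j k cj ck; rewrite /maxn; case: ifP.
by move=> k /asboolP.
Qed.

Lemma len_leq Y X k : (forall j, chain Y j X -> (j <= k)%N) -> (len Y X <= k)%N.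
Proof. by move=> le_k; apply/bigmax_leqP => j /asboolP/le_k. Qed.

Lemma lenS Y X Y' X' :
  {subset Y' <= Y} -> {subset X <= X'} -> (len Y X <= len Y' X')%N.
Proof.
move=> Y'Y XX'; apply: len_leq => j cj; apply: chain_len.
exact: chain_subl Y'Y (chain_subr XX' cj).
Qed.

Lemma len_eq0 Y X : {subset X <= Y} -> len Y X = 0%N.
Proof.
move=> XY; apply/eqP; rewrite -leqn0; apply: len_leq => -[|j] //= [W [cW _ []]].
by move=> x /XY/(chain_sub cW).
Qed.

Lemma len_gt0 Y X x : {subset Y <= X} -> x \in X -> x \notin Y ->
  (0 < len Y X)%N.
Proof.
move=> YX Xx /negP nYx; apply: chain_len; exists Y; split=> //.
by move=> /(_ x Xx).
Qed.

(* The modular law: a proper inclusion stays proper after intersecting with Z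
   or after adding Z, so a chain in [Y, X] splits between [Y, Z] and [Z, X]. *)
Lemma len_add Y Z X : {subset Y <= Z} -> {subset Z <= X} ->
  len Y X = (len Y Z + len Z X)%N.
Proof.
move=> YZ ZX; apply/eqP; rewrite eqn_leq andbC; apply/andP; split.
  exact: chain_len (chain_cat (lenP YZ) (lenP ZX)).
apply: len_leq => k cX.
have: exists i j, [/\ k = (i + j)%N, chain Y i (capsm X Z)
    & chain Z j (scalesm 1 X Z)].
  elim: k X {ZX} cX => [|k IH] X /= cX.
    exists 0%N, 0%N; split=> //=; last exact: sub_scalesm.
    by move=> y Yy; apply/andP; split; [apply: cX | apply: YZ].
  case: cX => W [/IH[i [j [-> ci cj]]] WX nXW].
  have capWX : {subset capsm W Z <= capsm X Z}.
    by move=> x /andP[/WX ? ?]; apply/andP.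
  have addWX : {subset scalesm 1 W Z <= scalesm 1 X Z}.
    by move=> x /scalesmP[u /WX Xu Zu]; apply/scalesmP; exists u.
  (* If the intersections with [Z] agree, the sums differ: for [x = u + z] with [u] in [W], the
     element [x - u] lies in [X] and [Z], hence in [W]. *)
  case: (pselect {subset capsm X Z <= capsm W Z}) => [cXW|nXW1]; last first.
    exists i.+1, j; split=> //; last exact: chain_subr addWX cj.
    by exists (capsm W Z : submodClosed V).
  exists i, j.+1; rewrite addnS; split=> //; first exact: chain_subr capWX ci.
  exists (scalesm 1 W Z : submodClosed V); split=> // aXW; apply: nXW => x Xx.
  have /aXW/scalesmP[u Wu]: x \in scalesm 1 X Z.
    by apply/scalesmP; exists x => //; rewrite scale1r subrr rpred0.
  rewrite scale1r => Zxu; apply: (submodBl _ Wu).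
  have /cXW/andP[//]: x - u \in capsm X Z.
  by apply/andP; split=> //; apply: submodB => //; apply: WX.
move=> [i [j [-> ci cj]]]; apply: leq_add; apply: chain_len.
  by apply: chain_subr ci => x /andP[].
apply: chain_subr cj => x /scalesmP[u Xu]; rewrite scale1r => /ZX Xxu.
exact: submodBl Xu.
Qed.

Lemma len_telescope (F : nat -> submodClosed V) n :
  (forall i, (i < n)%N -> {subset F i <= F i.+1}) ->
  {subset F 0 <= F n} /\
  len (F 0) (F n) = (\sum_(i < n) len (F i) (F i.+1))%N.
Proof.
elim: n => [|n IH] FS; first by rewrite big_ord0; split=> //; apply: len_eq0.
have [|F0n eqF] := IH; first by move=> i /ltnW; apply: FS.
have Fn := FS n (ltnSn n); split; first by move=> x /F0n/Fn.
by rewrite big_ord_recr /= -eqF; apply: len_add.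
Qed.

Lemma len_telescope_rev (F : nat -> submodClosed V) n :
  (forall i, (i < n)%N -> {subset F i.+1 <= F i}) ->
  len (F n) (F 0) = (\sum_(i < n) len (F i.+1) (F i))%N.
Proof.
move=> FS; have [|_] := @len_telescope (fun i => F (n - i)%N) n.
  by move=> i lt_in; rewrite -(subnSK lt_in); apply: FS; lia.
rewrite subn0 subnn => ->; rewrite (reindex_inj rev_ord_inj) /=.
by apply: eq_bigr => i _; have lt_in := ltn_ord i; congr (len (F _) (F _)); lia.
Qed.

(** Multiplication by [a] induces a surjection from [X / Y] to [X' / Y']; preimages carry chains
    back. *)
Lemma len_scale_surj a Y X Y' X' :
  {subset Y <= X} -> (forall y, y \in Y -> a *: y \in Y') ->
  (forall x', x' \in X' -> exists2 x, x \in X & x' - a *: x \in Y') ->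
  (len Y' X' <= len Y X)%N.
Proof.
move=> YX aY aX; apply: len_leq => k cX; apply: chain_len.
pose phi Z : submodClosed V := capsm X (preimsm a Z).
apply: (@chain_map phi) cX => [Z W YZ ZW WX'|y Yy|x /andP[] //].
  split=> [x /andP[Xx aZx]|phiWZ w Ww].
    by apply/andP; split=> //; apply: ZW.
  have [x Xx Y'x] := aX w (WX' w Ww); apply: (submodBl (YZ _ Y'x)).
  have /phiWZ/andP[//]: x \in phi W.
  by apply/andP; split=> //; apply: submodBr Ww; apply: ZW; apply: YZ.
by apply/andP; split; [apply: YX | apply: aY].
Qed.

(** Here scaling embeds [X / Y] in [X' / Y']; chains are pushed forward by taking images and adding
    [Y']. *)
Lemma len_scale_inj a Y X Y' X' :
  {subset Y' <= X'} -> (forall x, x \in X -> a *: x \in X') ->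
  (forall x, x \in X -> a *: x \in Y' -> x \in Y) ->
  (len Y X <= len Y' X')%N.
Proof.
move=> YX aX aY; apply: len_leq => k cX; apply: chain_len.
pose phi Z : submodClosed V := scalesm a Z Y'.
apply: (@chain_map phi) cX => [Z W YZ ZW WX||x /scalesmP[u Xu /YX X'x]].
- split=> [x /scalesmP[u Zu ?]|phiWZ w Ww].
    by apply/scalesmP; exists u => //; apply: ZW.
  have /phiWZ/scalesmP[u Zu Yu]: a *: w \in phi W.
    by apply/scalesmP; exists w => //; rewrite subrr rpred0.
  apply: (submodBl _ Zu); apply: YZ; apply: aY; last by rewrite scalerBr.
  by apply: submodB; apply: WX => //; apply: ZW.
- exact: sub_scalesm.
- by apply: submodBl X'x _; apply: aX.
Qed.

Lemma len_second_iso X S :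
  len (capsm X S) X = len S (scalesm 1 X S).
Proof.
apply/eqP; rewrite eqn_leq; apply/andP; split.
  apply: (@len_scale_inj 1); first exact: sub_scalesm.
    by move=> x Xx; apply/scalesmP; exists x => //; rewrite subrr rpred0.
  by move=> x Xx; rewrite scale1r => Sx; apply/andP.
apply: (@len_scale_surj 1) => [x /andP[] //|y /andP[_ Sy]|x /scalesmP //].
by rewrite scale1r.
Qed.

Section Uniformizer.
Variable p : R.
Hypothesis p_max :
  forall c, (exists d, c = d * p) \/ exists a b, a * c + b * p = 1.

(** Modulo [Y], [Z] sits in a cyclic module killed by [p], which is a quotient of the residue
    field. *)
Lemma len_cyclic_le1 Y Z x : p *: x \in Y ->
  (forall z, z \in Z -> exists c, z - c *: x \in Y) -> (len Y Z <= 1)%N.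
Proof.
move=> Ypx Zx; apply: len_leq => -[|[|k]] // cZ; exfalso.
have [W [[U [cU UW nWU]] WZ nZW]] := chain_leq (isT : 2 <= k.+2)%N cZ.
apply: nZW => z Zz.
have [w /andP[Ww nUw]] : exists w, (w \in W) && (w \notin U).
  apply: contrapT => nw; apply: nWU => w Ww; apply: contrapT => /negP Uw.
  by apply: nw; exists w; rewrite Ww.
have YU := cU : {subset Y <= U}.
have YW y : y \in Y -> y \in W by move=> /YU/UW.
have [c Yw] := Zx w (WZ w Ww); have [d Yz] := Zx z Zz.
(* Since [w] is not in [U], [p] cannot divide [c]; so [c] is invertible modulo [p], which puts [x],
   and hence [z], in [W]. *)
case: (p_max c) => [[e ce]|[a [b ab1]]].
  case/negP: nUw; apply: (submodBl (YU _ Yw)); apply: YU.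
  by rewrite ce -scalerA rpredZ.
apply: (submodBl (YW _ Yz)); apply: rpredZ.
have Wcx : c *: x \in W by apply: submodBr Ww; apply: YW.
rewrite -(scale1r x) -ab1 scalerDl -!scalerA.
by apply: rpredD; [|apply: YW]; apply: rpredZ.
Qed.

Lemma len_span_leq Y (x : nat -> V) n :
  (forall j, (j < n)%N -> p *: x j \in Y) ->
  (len Y (spansm Y x n) <= n)%N.
Proof.
move=> Ypx.
have [|_ eqF] := @len_telescope (fun i => spansm Y x i) n.
  by move=> i _; apply: spansmS.
apply: (@leq_trans (len (spansm Y x 0) (spansm Y x n))).
  by apply: lenS => // z; apply: spansm0.
rewrite eqF -[leqRHS](card_ord n) -sum1_card; apply: leq_sum => j _.
apply: (@len_cyclic_le1 _ _ (x j)); first by apply: sub_spansm; apply: Ypx.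
by move=> z /spansmSP.
Qed.

(* [U / pU] has the same length as the [p]-torsion of [U], here modulo [S]. *)
Lemma len_top_mono S U W :
  {subset S <= U} -> {subset U <= W} ->
  (len (scalesm p U S) U <= len (scalesm p W S) W)%N.
Proof.
move=> SU UW; pose K X : submodClosed V := capsm X (preimsm p S).
have SW : {subset S <= W} by move=> x /SU/UW.
have SK X : {subset S <= X} -> {subset S <= K X}.
  by move=> SX x Sx; apply/andP; split; [apply: SX | rewrite in_preimsm rpredZ].
have KX X : {subset K X <= X} by move=> x /andP[].
have sX X : {subset S <= X} -> {subset scalesm p X S <= X}.
  by move=> SX x /scalesmP[u Xu /SX Xx]; apply: submodBl Xx _; apply: rpredZ.
have injX X : (len (K X) X <= len S (scalesm p X S))%N.
  apply: (@len_scale_inj p); first exact: sub_scalesm.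
    by move=> x Xx; apply/scalesmP; exists x => //; rewrite subrr rpred0.
  by move=> x Xx Sx; apply/andP.
have surjX X : (len S (scalesm p X S) <= len (K X) X)%N.
  by apply: (@len_scale_surj p) => // [y /andP[]|x /scalesmP].
have KUW : (len S (K U) <= len S (K W))%N.
  by apply: lenS => // x /andP[/UW ? ?]; apply/andP.
have lenK X : {subset S <= X} -> len S X = (len S (K X) + len (K X) X)%N.
  by move=> SX; apply: len_add; [apply: SK | apply: KX].
have lenp X : {subset S <= X} ->
    len S X = (len S (scalesm p X S) + len (scalesm p X S) X)%N.
  by move=> SX; apply: len_add; [apply: sub_scalesm | apply: sX].
(* Each [len S X] splits along the torsion [K X] and along [p X + S]. Thus [injX] bounds the left
   side above by [len S (K U)], and [surjX] bounds the right side below by [len S (K W)]. *)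
move: (lenK _ SU) (lenp _ SU) (lenK _ SW) (lenp _ SW) (injX U) (surjX W).
lia.
Qed.

End Uniformizer.
End Length.
End Submodules.

(** * Partitions *)

Lemma sum_ord_ltn N c : (\sum_(j < N) (j < c) = minn N c)%N.
Proof.
elim: N => [|N IH]; first by rewrite big_ord0 min0n.
by rewrite big_ord_recr /= IH; lia.
Qed.

Lemma sum_ord_ltn_nth i la :
  (\sum_(j < size la) (i < nth 0 la j) = count (ltn i) la)%N.
Proof. by elim: la => [|k la IH]; rewrite ?big_ord0 // big_ord_recl /= IH. Qed.

(** [count (ltn i) la] is the part of index [i] of the conjugate partition: one box is read by
    columns and by rows. *)
Lemma ltn_nth_count i la j : sorted geq la ->
  (i < nth 0 la j)%N = (j < count (ltn i) la)%N.
Proof.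
elim: la j => [|k la IH] j /=; first by rewrite nth_nil.
move=> pla; have la_k : all (geq k) la.
  by apply: order_path_min pla => x y z xy yz; apply: leq_trans yz xy.
have IHj := IH _ (path_sorted pla); case: (ltnP i k) => [ik|ki].
  by case: j => [|j] /=; rewrite ?ik // IHj.
rewrite [count _ _](_ : _ = 0%N); last first.
  apply/eqP; rewrite -leqn0 leqNgt -has_count; apply/hasPn => x /(allP la_k) xk.
  by rewrite -leqNgt (leq_trans xk).
case: j => [|j] /=; first by rewrite ltnNge ki.
apply/negbTE; rewrite -leqNgt; case: (ltnP j (size la)) => [jla|?].
  by apply: leq_trans ki; apply: (allP la_k); apply: mem_nth.
by rewrite nth_default.
Qed.

Lemma leq_nth_sorted la j k : sorted geq la -> (j <= k)%N ->
  (nth 0 la k <= nth 0 la j)%N.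
Proof.
move=> sla jk; rewrite leqNgt ltn_nth_count // -leqNgt.
apply: contraTleq (leqnn (nth 0%N la j)) => ?.
by rewrite -ltnNge ltn_nth_count //; apply: leq_ltn_trans jk _.
Qed.

(** * Bases relative to a submodule *)

Section CyclicDecomposition.
Variables (R : comNzRingType) (p : R).

Lemma N_basis la : exists e : nat -> N_ p la,
  [/\ forall x, exists c : nat -> R, x = \sum_(j < size la) c j *: e j,
      forall j, p ^+ nth 0%N la j *: e j = 0
    & forall c : nat -> R, \sum_(j < size la) c j *: e j = 0 ->
        forall j, (j < size la)%N -> exists d, c j = d * p ^+ nth 0%N la j].
Proof.
elim: la => [|k la [e [e_gen e_tors e_free]]].
  (* Past the last part the generators vanish, as the default part 0 requires. *)
  exists (fun=> 0); split=> [x|j|//]; last by rewrite scaler0.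
  by exists (fun=> 0); rewrite big_ord0; apply: thinmx0.
pose one := \pi_(quot_mod (principal (p ^+ k))) (1 : R^o).
pose f j : N_ p (k :: la) := if j is j'.+1 then (0, e j') else (one, 0).
have one0 a : a *: one = 0 -> exists d, a = d * p ^+ k.
  rewrite -linearZ /= -[RHS](linear0 \pi_(quot_mod (principal (p ^+ k)))).
  move=> /eqP.
  rewrite pi_quot_modE subr0 => /asboolP[d].
  by rewrite /GRing.scale /= mulr1 => ->; exists d.
have sumf (c : nat -> R) : \sum_(j < (size la).+1) c j *: f j =
    (c 0%N *: one, \sum_(j < size la) c j.+1 *: e j).
  rewrite big_ord_recl /=.
  rewrite (_ : \sum_(i < _) _ = (0, \sum_(j < size la) c j.+1 *: e j));
    last first.
    apply: (big_rec2 (fun x y => x = (0, y))) => // j x y _ ->.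
    by congr pair; rewrite /= scaler0 addr0.
  by congr pair; rewrite /= ?addr0 // scaler0 add0r.
exists f; split=> [[x y]|[|j]|c].
- have [c ->] := e_gen y; have [r ->] := pi_quot_mod_surj x.
  pose c' j := if j is j'.+1 then c j' else r.
  exists c'; symmetry; apply: (etrans (sumf c')).
  congr pair.
  by rewrite -linearZ /= /GRing.scale /= mulr1.
- congr pair; rewrite /= ?scaler0 // -linearZ /=.
  rewrite -[RHS](linear0 \pi_(quot_mod (principal (p ^+ k)))).
  apply/eqP; rewrite pi_quot_modE subr0; apply/asboolP.
  by exists 1; rewrite mulrC.
- by congr pair; rewrite /= ?scaler0.
- move=> /(etrans (esym (sumf c)))[/one0 c0 cS] [|j] /=.
    by move=> _; exact: c0.
  exact: (e_free (c \o S)).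
Qed.

Section RelativeBasis.
Variable V : lmodType R.
Implicit Types S X Y : submodClosed V.

(* [b] lifts a basis of [V / S] adapted to a decomposition of type [la]. *)
Definition rel_basis S (la : seq nat) (b : nat -> V) : Prop :=
  [/\ forall x, exists c : nat -> R, x - \sum_(j < size la) c j *: b j \in S,
      forall j, p ^+ nth 0%N la j *: b j \in S
    & forall c : nat -> R, \sum_(j < size la) c j *: b j \in S ->
        forall j, (j < size la)%N -> exists d, c j = d * p ^+ nth 0%N la j].

(** [h] is a section of sets only: lifts of the generators suffice, as all three conditions are
    checked after applying [g]. *)
Lemma rel_basis_surj S la (g : {linear V -> N_ p la}) h : cancel h g ->
  (forall x, g x = 0 <-> x \in S) -> exists b, rel_basis S la b.
Proof.
move=> hK gS; have [e [e_gen e_tors e_free]] := N_basis la.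
have gsum (c : nat -> R) : g (\sum_(j < size la) c j *: h (e j)) =
    \sum_(j < size la) c j *: e j.
  by rewrite linear_sum; apply: eq_bigr => j _; rewrite linearZ /= hK.
exists (h \o e); split=> [x|j|c Sc].
- have [c gx] := e_gen (g x); exists c; apply/gS.
  by rewrite linearB /= gsum gx subrr.
- by apply/gS; rewrite linearZ /= hK.
- by apply: e_free; rewrite -gsum; apply/gS.
Qed.

Lemma has_type_basis la : has_type p V la ->
  exists b, rel_basis (@zerosm R V) la b.
Proof.
move=> [_ [f [h hK fK]]]; apply: (@rel_basis_surj _ _ f h) => // x.
split=> [fx0|/eqP->]; last exact: linear0.
by apply/eqP; rewrite -(hK x) fx0 -(linear0 f) hK.
Qed.

Lemma has_type_quot_basis S la : has_type p (quot_mod S) la ->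
  exists b, rel_basis S la b.
Proof.
move=> [_ [f [h hK fK]]].
pose g : {linear V -> N_ p la} := f \o \pi_(quot_mod S).
apply: (@rel_basis_surj _ _ g (repr \o h)) => [x|x] /=.
  by rewrite reprK fK.
rewrite -(subr0 x) -pi_quot_modE subr0 linear0.
split=> [fx0|/eqP->]; last exact: linear0.
by apply/eqP; rewrite -(hK (\pi_(quot_mod S) x)) fx0 -(linear0 f) hK.
Qed.

Lemma rel_basis_exp S la b N x : rel_basis S la b -> sorted geq la ->
  (head 0 la <= N)%N -> p ^+ N *: x \in S.
Proof.
move=> [b_gen b_tors _] sla laN; have [c Sx] := b_gen x.
have SNx : p ^+ N *: (x - \sum_(j < size la) c j *: b j) \in S.
  by rewrite rpredZ.
apply: submodBl (_ : _ - p ^+ N *: \sum_(j < size la) c j *: b j \in S) _.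
  by rewrite -scalerBr.
rewrite scaler_sumr; apply: rpred_sum => j _; rewrite scalerA mulrC -scalerA.
have le_jN : (nth 0%N la j <= N)%N.
  by apply: leq_trans laN; rewrite -nth0 leq_nth_sorted.
by apply: rpredZ; rewrite -(subnK le_jN) exprD -scalerA rpredZ.
Qed.

End RelativeBasis.
End CyclicDecomposition.

(** * Types and lengths *)

Section Types.
Variables (R : idomainType) (p : R) (V : lmodType R).
Implicit Types S U X Y : submodClosed V.
Hypothesis finV : finite_length V.
Hypothesis p_neq0 : p != 0.
Hypothesis p_nonunit : forall d, d * p != 1.
Hypothesis p_max :
  forall c, (exists d, c = d * p) \/ exists a b, a * c + b * p = 1.

(** With [e] the coordinates of [v], the coefficient of [b j] is [p ^+ i * (1 - p * e j)].
    Membership in [S] would make it divisible by a higher power of [p], and cancelling [p ^+ i]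
    would make [p] a unit. *)
Lemma rel_basis_indep S la b i j (c : nat -> R) v :
  rel_basis p S la b -> (i < nth 0 la j)%N ->
  p ^+ i *: b j - \sum_(k < j) c k *: b k - p ^+ i.+1 *: v \notin S.
Proof.
move=> [b_gen _ b_free] ij; apply/negP => Sij; have [e Sv] := b_gen v.
have jla : (j < size la)%N.
  by case: (ltnP j (size la)) ij => // ?; rewrite nth_default.
pose a k := (if k == j then p ^+ i else 0) - (if (k < j)%N then c k else 0)
            - p ^+ i.+1 * e k.
have aE : \sum_(k < size la) a k *: b k = p ^+ i *: b j -
    \sum_(k < j) c k *: b k - p ^+ i.+1 *: \sum_(k < size la) e k *: b k.
  rewrite scaler_sumr; under eq_bigr do rewrite !scalerBl -scalerA.
  rewrite !sumrB; congr (_ - _ - _).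
    rewrite (bigD1 (Ordinal jla)) //= eqxx big1 ?addr0 // => k /negPf kj.
    by rewrite -[k == j :> nat]/(k == Ordinal jla) kj scale0r.
  rewrite (big_ord_widen _ (fun k => c k *: b k) (ltnW jla)) [RHS]big_mkcond.
  by apply: eq_bigr => k _; case: ifP => //; rewrite scale0r.
have Sa : \sum_(k < size la) a k *: b k \in S.
  rewrite aE -[X in _ - X](subKr (p ^+ i.+1 *: v)) -scalerBr opprB addrA.
  rewrite addrAC; apply: rpredD; first exact: Sij.
  by apply: rpredZ.
have [d] := b_free _ Sa j jla; rewrite /a eqxx ltnn subr0 => /eqP.
rewrite -(subnKC ij) exprD mulrCA exprSr -{1}[p ^+ i]mulr1 -!mulrA -mulrBr.
rewrite (inj_eq (mulfI _)) ?expf_neq0 // subr_eq -mulrDr mulrC => /eqP e1.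
by have := p_nonunit (d * p ^+ (nth 0%N la j - i.+1) + e j); rewrite -e1 eqxx.
Qed.

(* The dimension of [p^i (V / S)] modulo [p^(i+1) (V / S)] over the residue
   field. *)
Definition layer S i :=
  len finV (scalesm (p ^+ i.+1) (@topsm R V) S)
           (scalesm (p ^+ i) (@topsm R V) S).

Lemma scalesm_exp_sub q X S : {subset S <= X} ->
  {subset scalesm (q * p) X S <= scalesm q X S}.
Proof.
move=> SX x /scalesmP[u Xu Sx]; apply/scalesmP; exists (p *: u).
  exact: rpredZ.
by rewrite scalerA.
Qed.

Lemma scalesm_comp i X S :
  scalesm p (scalesm (p ^+ i) X S) S =i scalesm (p ^+ i.+1) X S.
Proof.
move=> x; apply/scalesmP/scalesmP => -[u Xu Sx].
  have [v Xv Su] := scalesmP _ _ _ _ Xu; exists v => //.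
  rewrite exprS -scalerA -(subrK (p *: u) x) -addrA -scalerBr.
  by rewrite rpredD ?rpredZ.
exists (p ^+ i *: u); last by rewrite scalerA -exprS.
by apply/scalesmP; exists u => //; rewrite subrr rpred0.
Qed.

(** Adjoining the elements [p ^+ i *: b j] one at a time adds length 1 when [i] is below the part of
    index [j], by independence, and 0 otherwise, as the element then lies in [S]. *)
Lemma layer_rel_basis S la b i : rel_basis p S la b ->
  layer S i = count (ltn i) la.
Proof.
move=> Sb; have [b_gen b_tors _] := Sb.
pose T k : submodClosed V := scalesm (p ^+ k) (@topsm R V) S.
pose F j : submodClosed V := spansm (T i.+1) (fun k => p ^+ i *: b k) j.
have ST k : {subset S <= T k} by apply: sub_scalesm.
have Tp k v : p ^+ k *: v \in T k.
  by apply/scalesmP; exists v => //; rewrite subrr rpred0.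
have TT : {subset T i.+1 <= T i}.
  by rewrite /T exprSr; apply: scalesm_exp_sub.
transitivity (len finV (F 0%N) (F (size la))).
  apply/eqP; rewrite eqn_leq; apply/andP; split; apply: lenS => x.
  - exact: spansm0.
  - move=> /scalesmP[u _ Sx]; have [c Su] := b_gen u.
    apply/spansmP; exists c; apply: ST.
    rewrite -(subrK (p ^+ i *: u) x) -addrA rpredD //.
    under eq_bigr do rewrite scalerA mulrC -scalerA.
    by rewrite -scaler_sumr -scalerBr rpredZ.
  - exact: sub_spansm.
  - move=> /spansmP[c /TT Tx]; apply: submodBl Tx _.
    by apply: rpred_sum => j _; rewrite rpredZ.
have [|_ ->] := @len_telescope _ _ finV F (size la).
  by move=> j _; apply: spansmS.
rewrite -sum_ord_ltn_nth; apply: eq_bigr => j _.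
case: ltnP => [ij|ji].
  apply/eqP; rewrite eqn_leq; apply/andP; split.
    apply: (@len_cyclic_le1 _ _ _ _ p_max _ _ (p ^+ i *: b j)).
      by apply: sub_spansm; rewrite scalerA -exprS Tp.
    by move=> z /spansmSP.
  apply: (@len_gt0 _ _ _ _ _ (p ^+ i *: b j)); first exact: spansmS.
    exact: (@mem_spansmS _ _ _ (fun k => p ^+ i *: b k)).
  apply/negP => /spansmP[c /scalesmP[v _]]; apply/negP.
  under eq_bigr do rewrite scalerA.
  exact: (rel_basis_indep (fun k => c k * p ^+ i) v Sb ij).
apply: len_eq0 => z /spansmSP[c Fz]; apply: submodBl Fz _; apply: rpredZ.
apply: sub_spansm; apply: ST.
by rewrite -(subnK ji) exprD -scalerA rpredZ.
Qed.

(** The projection of [V / S] onto [V / S'] maps layers onto layers, so the conjugate partitions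
    compare. *)
Lemma rel_basis_nthS S S' la la' b b' :
  rel_basis p S la b -> rel_basis p S' la' b' ->
  sorted geq la -> sorted geq la' -> {subset S <= S'} ->
  forall j, (nth 0 la' j <= nth 0 la j)%N.
Proof.
move=> Sb Sb' sla sla' SS' j; rewrite leqNgt ltn_nth_count // -leqNgt.
(* For this [i], at most [j] parts of [la] exceed [i]; the layers pass this bound on to [la']. *)
set i := nth 0%N la j; have: ~~ (i < nth 0 la j)%N by rewrite ltnn.
rewrite ltn_nth_count // -leqNgt; apply: leq_trans.
rewrite -(layer_rel_basis i Sb) -(layer_rel_basis i Sb').
apply: (@len_scale_surj _ _ _ 1) => [x|x|x].
- by rewrite exprSr; apply: scalesm_exp_sub.
- rewrite scale1r => /scalesmP[u _ Su]; apply/scalesmP; exists u => //.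
  exact: SS'.
- move=> /scalesmP[u _ Su]; exists (p ^+ i *: u).
    by apply/scalesmP; exists u => //; rewrite subrr rpred0.
  by rewrite scale1r; apply: sub_scalesm.
Qed.

(* Multiplication by [p] maps [V / S'] onto [p (V / S)]. *)
Lemma rel_basis_nth_leS S S' la la' b b' :
  rel_basis p S la b -> rel_basis p S' la' b' ->
  sorted geq la -> sorted geq la' -> (forall x, x \in S' -> p *: x \in S) ->
  forall j, (nth 0 la j <= (nth 0 la' j).+1)%N.
Proof.
move=> Sb Sb' sla sla' pS j; rewrite leqNgt ltn_nth_count // -leqNgt.
set i := nth 0%N la' j; have: ~~ (i < nth 0 la' j)%N by rewrite ltnn.
rewrite ltn_nth_count // -leqNgt; apply: leq_trans.
rewrite -(layer_rel_basis i.+1 Sb) -(layer_rel_basis i Sb').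
apply: (@len_scale_surj _ _ _ p) => [x|x|x].
- by rewrite exprSr; apply: scalesm_exp_sub.
- move=> /scalesmP[u _ Su]; apply/scalesmP; exists u => //.
  by rewrite exprS -scalerA -scalerBr pS.
- move=> /scalesmP[u _ Su]; exists (p ^+ i *: u).
    by apply/scalesmP; exists u => //; rewrite subrr rpred0.
  by rewrite scalerA -exprS; apply: sub_scalesm.
Qed.

(** The span modulo [S] is filtered by powers of [p]. Its layer [i] is bounded by [m], the number of
    generators, and by the layer of [V / S], through [len_top_mono]. The minima of these bounds add
    up to the boxes in the first [m] columns. *)
Lemma len_span_leq_type S la b (x : nat -> V) m :
  rel_basis p S la b -> sorted geq la ->
  (len finV S (spansm S x m) <= \sum_(j < m) nth 0 la j)%N.
Proof.
move=> Sb sla; pose Z : submodClosed V := spansm S x m.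
have SZ : {subset S <= Z} by apply: sub_spansm.
pose G i : submodClosed V := scalesm (p ^+ i) Z S.
have SG i : {subset S <= G i} by apply: sub_scalesm.
set N := head 0%N la.
(* [N] is the largest part, so [p ^+ N] kills [V / S] and the filtration ends inside [S]. *)
have: (len finV S Z <= len finV (G N) (G 0%N))%N.
  apply: lenS => y.
    move=> /scalesmP[u _ Sy]; apply: submodBl Sy _.
    exact: rel_basis_exp Sb sla (leqnn _).
  by move=> Zy; apply/scalesmP; exists y => //; rewrite scale1r subrr rpred0.
rewrite (@len_telescope_rev _ _ _ G) => [|i _]; last first.
  by rewrite /G exprSr; apply: scalesm_exp_sub.
move/leq_trans; apply.
apply: (@leq_trans (\sum_(i < N) minn m (count (ltn i) la))).
  apply: leq_sum => i _; rewrite leq_min; apply/andP; split.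
    pose px j := p ^+ i *: x j.
    apply: (@leq_trans (len finV (G i.+1) (spansm (G i.+1) px m))).
      apply: lenS => // y /scalesmP[u /spansmP[c Su] Sy].
      apply/spansmP; exists c; apply: SG.
      rewrite -(subrK (p ^+ i *: u) y) -addrA rpredD //.
      under eq_bigr do rewrite scalerA mulrC -scalerA.
      by rewrite -scaler_sumr -scalerBr rpredZ.
    apply: len_span_leq p_max _ _ _ _ => j jm.
    apply/scalesmP; exists (x j); last by rewrite scalerA exprS subrr rpred0.
    apply/spansmP; exists (fun k => (k == j)%:R).
    rewrite (bigD1 (Ordinal jm)) //= eqxx scale1r big1 ?addr0 ?subrr ?rpred0 //.
    move=> k /negPf kj.
    by rewrite -[k == j :> nat]/(k == Ordinal jm) kj scale0r.
  rewrite -(layer_rel_basis i Sb).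
  pose T : submodClosed V := scalesm (p ^+ i) (@topsm R V) S.
  have ST : {subset S <= T} by apply: sub_scalesm.
  have GT : {subset G i <= T}.
    by move=> y /scalesmP[u _ Sy]; apply/scalesmP; exists u.
  apply: leq_trans (leq_trans (len_top_mono finV p (SG i) GT) _).
    by apply: lenS => // y; rewrite scalesm_comp.
  by apply: lenS => // y; rewrite -scalesm_comp.
rewrite (eq_bigr (fun i : 'I_N => \sum_(j < m) (i < nth 0 la j)%N)%N) => [|i _].
  rewrite exchange_big; apply: leq_sum => j _ /=.
  by rewrite sum_ord_ltn geq_minr.
by rewrite -sum_ord_ltn; apply: eq_bigr => j _; rewrite ltn_nth_count.
Qed.

(** Over the span of the earlier elements, the multiples [p ^+ i *: b j] generate strictly
    decreasing submodules while [i] runs up to the part of index [j], by independence. *)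
Lemma len_span_basis_geq S la b m : rel_basis p S la b ->
  (\sum_(j < m) nth 0 la j <= len finV S (spansm S b m))%N.
Proof.
move=> Sb; have [|_ eqF] := @len_telescope _ _ finV (fun i => spansm S b i) m.
  by move=> i _; apply: spansmS.
apply: (@leq_trans (len finV (spansm S b 0) (spansm S b m))); last first.
  by apply: lenS => // z; apply: sub_spansm.
rewrite eqF; apply: leq_sum => j _.
pose E : submodClosed V := spansm S b j.
pose H i : submodClosed V := spansm E (fun=> p ^+ i *: b j) 1.
have HE i z : z \in H i -> exists c : R, z - c *: (p ^+ i *: b j) \in E.
  by move=> /spansmSP[c /spansm0]; exists c.
have HS i : {subset H i.+1 <= H i}.
  move=> z /HE[c Ez]; apply/spansmSP; exists (c * p); apply: sub_spansm.
  by move: Ez; rewrite exprS -!scalerA.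
set n := nth 0%N la j.
have leH : (len finV (H n) (H 0%N) <= len finV E (spansm S b j.+1))%N.
  apply: lenS => z; first exact: sub_spansm.
  by move=> /HE[c]; rewrite scale1r => Ez; apply/spansmSP; exists c.
apply: leq_trans leH.
rewrite (len_telescope_rev finV) => [|i _]; last exact: HS.
rewrite -[leqLHS]card_ord -sum1_card; apply: leq_sum => i _.
apply: (@len_gt0 _ _ _ _ _ (p ^+ i *: b j)).
- exact: HS.
- exact: (@mem_spansmS _ _ _ (fun=> p ^+ i *: b j)).
- apply/negP => /HE[c /spansmP[d]]; apply/negP.
  rewrite scalerA mulrC -scalerA addrAC.
  exact: rel_basis_indep Sb (ltn_ord i).
Qed.

Lemma socle_types_convex (A : submodClosed V) l la0 la1 la2 b0 b1 b2 m :
  rel_basis p (soc p A l) la0 b0 -> rel_basis p (soc p A l.+1) la1 b1 ->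
  rel_basis p (soc p A l.+2) la2 b2 ->
  sorted geq la0 -> sorted geq la1 -> sorted geq la2 ->
  (\sum_(j < m) nth 0 la1 j + \sum_(j < m) nth 0 la1 j <=
   \sum_(j < m) nth 0 la0 j + \sum_(j < m) nth 0 la2 j)%N.
Proof.
move=> B0 B1 B2 s0 s1 s2; pose X : submodClosed V := spansm (@zerosm R V) b1 m.
(* [X] attains the maximal length at [l.+1]; at [l] and [l.+2] it only gives a
   lower bound. *)
pose C i : submodClosed V := capsm X (soc p A i).
have CX i : {subset C i <= X} by move=> x /andP[].
have CS i : {subset C i <= C i.+1}.
  move=> x /andP[Xx /andP[Ax /eqP px]]; apply/andP; split=> //.
  by apply/andP; rewrite exprS -scalerA px scaler0 eqxx.
(* [X / C i] is the image of [X] modulo [soc p A i], so the bounds for spans of [m] elements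
   apply. *)
have lenC i : len finV (C i) X = len finV (soc p A i) (spansm (soc p A i) b1 m).
  rewrite len_second_iso; apply/eqP; rewrite eqn_leq; apply/andP; split.
    apply: lenS => // x /scalesmP[u /spansmP[c /eqP/subr0_eq ->]].
    by rewrite scale1r => Sx; apply/spansmP; exists c.
  apply: lenS => // x /spansmP[c Sx]; apply/scalesmP.
  exists (\sum_(j < m) c j *: b1 j); last by rewrite scale1r.
  by apply/spansmP; exists c; rewrite subrr rpred0.
have h0 : (len finV (C l) X <= \sum_(j < m) nth 0 la0 j)%N.
  by rewrite lenC; apply: len_span_leq_type B0 s0.
have h2 : (len finV (C l.+2) X <= \sum_(j < m) nth 0 la2 j)%N.
  by rewrite lenC; apply: len_span_leq_type B2 s2.
have h1 : (\sum_(j < m) nth 0 la1 j <= len finV (C l.+1) X)%N.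
  by rewrite lenC; apply: len_span_basis_geq B1.
have h : (len finV (C l.+1) (C l.+2) <= len finV (C l) (C l.+1))%N.
  apply: (@len_scale_inj _ _ _ p) => // x /andP[Xx /andP[Ax /eqP px]].
    apply/andP; split; first exact: rpredZ.
    by apply/andP; split; [apply: rpredZ | rewrite scalerA -exprSr px].
  move=> /andP[_ /andP[_ ppx]]; apply/andP; split=> //.
  by apply/andP; rewrite exprSr -scalerA.
(* With [u], [v], [w] the lengths of the successive quotients up to [X], it remains that
   [2 * (v + w) <= (u + v + w) + w]. *)
have e1 := len_add finV (@CS l) (CX l.+1).
have e2 := len_add finV (@CS l.+1) (CX l.+2).
lia.
Qed.

End Types.

(** * Fillings *)

Section Filling.
(** [sigma l j] stands for the length of column [j] at level [l], 0 past the last column. Modules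
    enter the combinatorics only through the hypotheses below. *)
Variables (sigma : nat -> nat -> nat) (s : nat) (be ga : seq nat).
Variable T : nat -> nat -> nat.
Hypothesis sigma0 : forall j, sigma 0 j = nth 0%N be j.
Hypothesis sigma_s : forall j, sigma s j = nth 0%N ga j.
Hypothesis sigmaS : forall l j, (l < s)%N -> (sigma l.+1 j <= sigma l j)%N.
Hypothesis sigma_leS :
  forall l j, (l < s)%N -> (sigma l j <= (sigma l.+1 j).+1)%N.
Hypothesis sigma_sorted :
  forall l j k, (l <= s)%N -> (j <= k)%N -> (sigma l k <= sigma l j)%N.
Hypothesis sigma_convex : forall l m, (l.+1 < s)%N ->
  (\sum_(j < m) sigma l.+1 j + \sum_(j < m) sigma l.+1 j <=
   \sum_(j < m) sigma l j + \sum_(j < m) sigma l.+2 j)%N.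
Hypothesis TE :
  forall l r j, (l < s)%N -> (sigma l.+1 j < r <= sigma l j)%N -> T r j = l.+1.

Lemma sigma_mono l k j : (l <= k <= s)%N -> (sigma k j <= sigma l j)%N.
Proof.
case/andP; elim: k => [|k IH]; first by rewrite leqn0 => /eqP->.
rewrite leq_eqVlt => /predU1P[-> //|lk ks].
exact: leq_trans (sigmaS j ks) (IH lk (ltnW ks)).
Qed.

(** The column length falls from at least [r] at level 0 to below [r] at level [s], so some step
    crosses [r]. *)
Lemma in_skew_level r j : in_skew be ga r j ->
  exists2 l, (l < s)%N & (sigma l.+1 j < r <= sigma l j)%N.
Proof.
rewrite /in_skew -sigma0 -sigma_s => /andP[]; move: (leqnn s).
elim: {1 3}s => [|k IH] ks lo hi.
  by move: (leq_trans lo hi); rewrite ltnn.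
case: (leqP r (sigma k j)) => [rk|?]; first by exists k; rewrite ?lo.
by apply: IH => //; lia.
Qed.

Lemma level_in_skew l r j : (l < s)%N -> (sigma l.+1 j < r <= sigma l j)%N ->
  in_skew be ga r j.
Proof.
move=> ls /andP[lo hi]; rewrite /in_skew -sigma0 -sigma_s.
rewrite (leq_ltn_trans _ lo) ?(leq_trans hi) ?sigma_mono ?ls ?leqnn //.
exact: ltnW.
Qed.

(** A larger entry on the right would give [r <= sigma l' k <= sigma l.+1 k <= sigma l.+1 j < r]. *)
Lemma filling_ST1 : ST1 be ga T.
Proof.
move=> r j k jk /in_skew_level[l ls rl] /in_skew_level[l' ls' rl'].
rewrite (TE ls rl) (TE ls' rl') ltnS leqNgt; apply/negP => ll'.
have := @sigma_mono l.+1 l' k; have := @sigma_sorted l.+1 j k ls (ltnW jk).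
rewrite ll' (ltnW ls'); lia.
Qed.

(** A level removes at most one box per column, so the two levels differ; a later level for the
    lower box would give [r' <= sigma l' j <= sigma l.+1 j < r]. *)
Lemma filling_ST2 : ST2 be ga T.
Proof.
move=> j r r' rr' /in_skew_level[l ls rl] /in_skew_level[l' ls' rl'].
rewrite (TE ls rl) (TE ls' rl') ltnS ltnNge; apply/negP.
rewrite leq_eqVlt => /predU1P[ll'|ll'].
  by have := sigma_leS j ls; rewrite -ll' in rl'; lia.
by have := @sigma_mono l.+1 l' j; rewrite ll' (ltnW ls'); lia.
Qed.

(** Column [j] has [sigma l j - sigma l.+1 j] entries [l.+1]; the additive form avoids truncated
    subtraction. The minimum is there because boxes lie only in the columns of [be]. *)
Lemma card_boxes_left m l : (l < s)%N ->
  (#|boxes_left be ga T m l.+1| + \sum_(j < minn m (size be)) sigma l.+1 j =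
   \sum_(j < minn m (size be)) sigma l j)%N.
Proof.
move=> ls; pose M := (head 0%N be).+1.
have box r j : in_skew be ga r j && (T r j == l.+1) =
               (sigma l.+1 j < r <= sigma l j)%N.
  apply/andP/idP => [[/in_skew_level[k ks rk]]|rl].
    by rewrite (TE ks rk) => /eqP[<-].
  by rewrite (level_in_skew ls rl) (TE ls rl).
have widen (F : nat -> nat) : (\sum_(j < minn m (size be)) F j =
                \sum_(j < size be | (j < m)%N) F j)%N.
  rewrite (big_ord_widen _ F (geq_minr m (size be))).
  by apply: eq_bigl => j; rewrite leq_min ltn_ord andbT.
rewrite !widen (_ : #|_| = \sum_(j < size be | (j < m)%N)
    \sum_(r < M) (sigma l.+1 j < r <= sigma l j)%N)%N; last first.
  rewrite -sum1_card (eq_bigl (fun b : 'I_M * 'I_(size be) =>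
    (b.2 < m)%N && (sigma l.+1 b.2 < b.1 <= sigma l b.2)%N)); last first.
    by move=> b; rewrite inE -box andbCA.
  under [RHS]eq_bigr do rewrite -big_mkcond.
  rewrite (exchange_big_dep xpredT) //= pair_big_dep /=.
  by apply: eq_bigl => b; rewrite andbC.
rewrite -big_split /=; apply: eq_bigr => j _.
(* The first column of [be] is the longest, so [M] leaves room for every row. *)
have sl : (sigma l j < M)%N.
  rewrite ltnS -nth0 -sigma0; apply: (@leq_trans (sigma 0 j)).
    by apply: sigma_mono; rewrite (ltnW ls).
  exact: sigma_sorted.
have sS := sigmaS j ls.
have : (\sum_(r < M) (r < (sigma l j).+1) =
  \sum_(r < M) (sigma l.+1 j < r <= sigma l j) +
  \sum_(r < M) (r < (sigma l.+1 j).+1))%N.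
  by rewrite -big_split; apply: eq_bigr => r _ /=; lia.
by rewrite !sum_ord_ltn; move: (\sum_(r < M) _)%N => n; lia.
Qed.

(** The entries [l.+1] in the first [m] columns number [f_m l - f_m l.+1], and convexity makes these
    differences weakly decreasing in [l]. *)
Lemma filling_ST3 : ST3 be ga T.
Proof.
(* Entries are at most [s], so [l.+2] does not occur when [s <= l.+1]. *)
move=> m [//|l] _; case: (ltnP l.+1 s) => [ls|sl]; last first.
  rewrite (_ : boxes_left _ _ _ _ _ = set0) ?cards0 //; apply/setP => b.
  rewrite !inE; apply/negP => /and3P[/in_skew_level[k ks /(TE ks)->] _ /eqP[]].
  by lia.
have := card_boxes_left m ls; have := card_boxes_left m (ltnW ls).
by have := sigma_convex (minn m (size be)) ls; lia.
Qed.

End Filling.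

(** * Uniformizers and the assembly of the theorem *)

Lemma uniformizer_max (R : idomainType) (p : R) : uniformizer p ->
  forall c, (exists d, c = d * p) \/ exists a b, a * c + b * p = 1.
Proof.
move=> [_ max_p] c.
(* Maximality is tested on the ideal generated by [p] and [c]. *)
pose J : submodClosed R^o := spansm (principal p) (fun=> c : R^o) 1.
have pJ : {subset principal p <= J} by apply: sub_spansm.
case: (boolP (1 \in J)) => [|/(max_p J pJ) pJE].
  move=> /spansmSP[a /spansm0/asboolP[b ab1]].
  by right; exists a, b; rewrite -ab1 addrC subrK.
left; have : (c : R^o) \in J by apply: (@mem_spansmS _ _ _ (fun=> c : R^o)).
by rewrite -pJE => /asboolP.
Qed.

(** By uniqueness the ideal of [p] is the given maximal ideal, which has a nonzero element. *)
Lemma uniformizer_neq0 (R : idomainType) (p : R) :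
  is_dvr R -> uniformizer p -> p != 0.
Proof.
move=> [_ [I [_ Iuniq [x Ix x_neq0]]]] p_unif; apply: contraNneq x_neq0 => p0.
by move: Ix; rewrite (Iuniq _ p_unif) => /asboolP[b ->]; rewrite p0 mulr0.
Qed.

Theorem proposition3p7 (R : idomainType) (p : R) (B : lmodType R)
    (A : submodClosed B) (al be ga : seq nat) (T : nat -> nat -> nat) :
  is_dvr R -> uniformizer p ->
  finite_length B ->
  has_type p (submod_type A) al ->
  has_type p B be ->
  has_type p (quot_mod A) ga ->
  is_socle_tableau p A al T ->
  [/\ ST1 be ga T, ST2 be ga T & ST3 be ga T].
Proof.
move=> dvrR p_unif finB al_type be_type ga_type [sigma [sigma_type TE]].
have p_max := uniformizer_max p_unif.
have p_neq0 := uniformizer_neq0 dvrR p_unif.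
have p_nonunit d : d * p != 1.
  by apply/eqP => dp1; case: p_unif => /asboolP[]; exists d; rewrite dp1.
set s := head 0%N al in sigma_type TE.
have sorted_type (M : lmodType R) la : has_type p M la -> sorted geq la.
  by case=> /andP[].
have sigma_sorted l (ls : (l <= s)%N) := sorted_type _ _ (sigma_type l ls).
have sigma_basis l (ls : (l <= s)%N) := has_type_quot_basis (sigma_type l ls).
have nthS := rel_basis_nthS finB p_neq0 p_nonunit p_max.
have nth_leS := rel_basis_nth_leS finB p_neq0 p_nonunit p_max.
have be_sorted := sorted_type _ _ be_type.
have ga_sorted := sorted_type _ _ ga_type.
have [bbe be_basis] := has_type_basis be_type.
have [bga ga_basis] := has_type_quot_basis ga_type.
(* The socle of exponent 0 is zero; comparing columns in both directions shows that the two types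
   agree. *)
have sigma0 j : nth 0%N (sigma 0) j = nth 0%N be j.
  have [b0 b0_basis] := sigma_basis 0 isT.
  have soc0 : soc p A 0 =i @zerosm R B.
    move=> x; apply/andP/idP => [[_]|/eqP->]; first by rewrite scale1r.
    by rewrite rpred0 scaler0.
  have s0_sorted := sigma_sorted 0%N isT.
  by apply/eqP; rewrite eqn_leq; apply/andP; split;
    [apply: (nthS _ _ _ _ _ _ be_basis b0_basis)
    |apply: (nthS _ _ _ _ _ _ b0_basis be_basis)] => // x; rewrite soc0.
have sigmas j : nth 0%N (sigma s) j = nth 0%N ga j.
  have [bs bs_basis] := sigma_basis s (leqnn s).
  have [bal al_basis] := has_type_basis al_type.
  (* [s] is the largest part of [al], so [p ^+ s] kills [A]. *)
  have socs : soc p A s =i A.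
    move=> x; apply/andP/idP => [[]//|Ax]; split=> //.
    have al_sorted := sorted_type _ _ al_type.
    have /eqP := rel_basis_exp (Sub x Ax) al_basis al_sorted (leqnn s).
    by move/(congr1 val); rewrite linearZ /= => ->.
  have ss_sorted := sigma_sorted s (leqnn s).
  by apply/eqP; rewrite eqn_leq; apply/andP; split;
    [apply: (nthS _ _ _ _ _ _ ga_basis bs_basis)
    |apply: (nthS _ _ _ _ _ _ bs_basis ga_basis)] => // x; rewrite socs.
have sigmaS l j : (l < s)%N -> (nth 0 (sigma l.+1) j <= nth 0 (sigma l) j)%N.
  move=> ls; have [b b_basis] := sigma_basis l (ltnW ls).
  have [b' b'_basis] := sigma_basis l.+1 ls.
  apply: (nthS _ _ _ _ _ _ b_basis b'_basis) => [||x /andP[Ax /eqP px]].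
  - exact: sigma_sorted (ltnW ls).
  - exact: sigma_sorted ls.
  apply/andP; split=> //.
  by rewrite exprS -scalerA px scaler0.
have sigma_leS l j : (l < s)%N ->
    (nth 0 (sigma l) j <= (nth 0 (sigma l.+1) j).+1)%N.
  move=> ls; have [b b_basis] := sigma_basis l (ltnW ls).
  have [b' b'_basis] := sigma_basis l.+1 ls.
  apply: (nth_leS _ _ _ _ _ _ b_basis b'_basis) => [||x /andP[Ax /eqP px]].
  - exact: sigma_sorted (ltnW ls).
  - exact: sigma_sorted ls.
  apply/andP; split; first exact: rpredZ.
  by rewrite scalerA -exprSr px.
pose sig l j := nth 0%N (sigma l) j.
have sig_sorted l j k : (l <= s)%N -> (j <= k)%N -> (sig l k <= sig l j)%N.
  by move=> ls; apply: leq_nth_sorted; apply: sigma_sorted.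
have sigTE l r j : (l < s)%N -> (sig l.+1 j < r <= sig l j)%N -> T r j = l.+1.
  by move=> ls; apply: TE.
have sig_convex l m : (l.+1 < s)%N ->
    (\sum_(j < m) sig l.+1 j + \sum_(j < m) sig l.+1 j <=
     \sum_(j < m) sig l j + \sum_(j < m) sig l.+2 j)%N.
  move=> ls; have [b0 B0] := sigma_basis l (ltnW (ltnW ls)).
  have [b1 B1] := sigma_basis l.+1 (ltnW ls).
  have [b2 B2] := sigma_basis l.+2 ls.
  apply: (socle_types_convex finB p_neq0 p_nonunit p_max m B0 B1 B2).
  - exact: sigma_sorted (ltnW (ltnW ls)).
  - exact: sigma_sorted (ltnW ls).
  - exact: sigma_sorted ls.
by split; [apply: (filling_ST1 (sigma := sig))
          |apply: (filling_ST2 (sigma := sig))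
          |apply: (filling_ST3 (sigma := sig))]; eassumption.
Qed.
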